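(* The hybrid DtP scheme for the parabolic matrix equation (defined in the context; backward Euler in the K- and L-steps, forward Euler in the S-step) is unconditionally $L^2$-stable: its iterates $U^n=X^nS^n(V^n)^T$ satisfy $$\|U^{n+1}\|_F\le \|U^n\|_F\qquad\text{for all }\Delta t>0.$$
   Context: Let $A\in\mathbb R^{N_v\times N_v}$ be symmetric positive semidefinite, $\Delta t,\Delta x>0$, and $\tau:=\frac{\Delta t}{(\Delta x)^2}$. $\|\cdot\|_F$ is the Frobenius norm. Let $E_+,E_-\in\mathbb R^{N_x\times N_x}$ be the periodic shift matrices $(E_+w)_j=w_{j+1}$, $(E_-w)_j=w_{j-1}$ (indices modulo $N_x$), and $M_2=2I-E_+-E_-$ (symmetric positive semidefinite). The underlying matrix equation is $\dot U=-\frac{1}{(\Delta x)^2}M_2UA$. Hybrid DtP (discretize-then-project) projector-splitting scheme of rank $r\le\min(N_x,N_v)$: the state at time level $n$ is $U^n=X^nS^n(V^n)^T$ with $X^n\in\mathbb R^{N_x\times r}$, $S^n\in\mathbb R^{r\times r}$, $V^n\in\mathbb R^{N_v\times r}$, $(X^n)^TX^n=I_r$, $(V^n)^TV^n=I_r$. One step from $n$ to $n+1$, with $K^n:=X^nS^n$ and $\widetilde A:=(V^n)^TAV^n$, is: K-step: solve $K^{n+1}=K^n-\tau M_2K^{n+1}\widetilde A$ for $K^{n+1}$ and take a QR factorization $K^{n+1}=X^{n+1}S^{(1)}$ with $X^{n+1}\in\mathbb R^{N_x\times r}$ having orthonormal columns. S-step: $S^{(2)}=S^{(1)}+\tau M_{2,X}S^{(1)}\widetilde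 A$, where $M_{2,X}:=(X^{n+1})^TM_2X^{n+1}$. L-step: with $L^n:=S^{(2)}(V^n)^T$, solve $L^{n+1}=L^n-\tau M_{2,X}L^{n+1}A$ for $L^{n+1}$ and take a QR factorization $(L^{n+1})^T=V^{n+1}(S^{n+1})^T$ with $V^{n+1}\in\mathbb R^{N_v\times r}$ having orthonormal columns. Then $U^{n+1}=X^{n+1}S^{n+1}(V^{n+1})^T=X^{n+1}L^{n+1}$. *)

(* Defs.v *)
From mathcomp Require Export all_boot all_order all_algebra.
From mathcomp Require Export reals.

Set Implicit Arguments.
Unset Strict Implicit.
Unset Printing Implicit Defensive.

Import Order.TTheory GRing.Theory Num.Theory.

Local Open Scope ring_scope.

Definition frobenius_norm (R : realType) m n (B : 'M[R]_(m, n)) : R :=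
  Num.sqrt (\sum_i \sum_j B i j ^+ 2).

Definition sym_psd (R : realType) n (B : 'M[R]_n) : Prop :=
  B^T = B /\ forall x : 'cV[R]_n, 0 <= (x^T *m B *m x) 0 0.

Definition orthonormal_cols (R : realType) m n (Q : 'M[R]_(m, n)) : Prop :=
  Q^T *m Q = 1%:M.

(* [is_trig_mx] means lower triangular, hence the transpose: the second factor
   of a QR factorization is upper triangular. *)
Definition is_QR (R : realType) m n (B Q : 'M[R]_(m, n)) (T : 'M[R]_n) : Prop :=
  [/\ B = Q *m T, orthonormal_cols Q & is_trig_mx T^T].

Definition shift_fwd (R : realType) n : 'M[R]_n :=
  \matrix_(i, j) (j == ordS i)%:R.

Definition shift_bwd (R : realType) n : 'M[R]_n :=
  \matrix_(i, j) (j == ord_pred i)%:R.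

Lemma shift_fwdE (R : realType) n (w : 'cV[R]_n) j :
  (shift_fwd R n *m w) j 0 = w (ordS j) 0.
Proof.
rewrite mxE (bigD1 (ordS j)) //= mxE eqxx mul1r big1 ?addr0 // => k.
by rewrite mxE => /negPf ->; rewrite mul0r.
Qed.

Lemma shift_bwdE (R : realType) n (w : 'cV[R]_n) j :
  (shift_bwd R n *m w) j 0 = w (ord_pred j) 0.
Proof.
rewrite mxE (bigD1 (ord_pred j)) //= mxE eqxx mul1r big1 ?addr0 // => k.
by rewrite mxE => /negPf ->; rewrite mul0r.
Qed.

Definition M2 (R : realType) n : 'M[R]_n :=
  2%:M - shift_fwd R n - shift_bwd R n.

Section HybridDtP.

Variables (R : realType) (Nx Nv r : nat) (A : 'M[R]_Nv) (dt dx : R).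

(* The step is a relation because the QR factors are not unique. *)
Definition hybrid_dtp_step
    (X : 'M[R]_(Nx, r)) (S : 'M[R]_r) (V : 'M[R]_(Nv, r))
    (X' : 'M[R]_(Nx, r)) (S' : 'M[R]_r) (V' : 'M[R]_(Nv, r)) : Prop :=
  let tau := dt / dx ^+ 2 in
  let K := X *m S in
  let At := V^T *m A *m V in
  let M2X := X'^T *m M2 R Nx *m X' in
  exists (K' : 'M[R]_(Nx, r)) (S1 S2 : 'M[R]_r) (L' : 'M[R]_(r, Nv)),
    let L := S2 *m V^T in
    [/\ K' = K - tau *: (M2 R Nx *m K' *m At),
        is_QR K' X' S1,
        S2 = S1 + tau *: (M2X *m S1 *m At),
        L' = L - tau *: (M2X *m L' *m A)
      & is_QR L'^T V' S'^T].

Definition hybrid_dtp_iterates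
    (X : nat -> 'M[R]_(Nx, r)) (S : nat -> 'M[R]_r)
    (V : nat -> 'M[R]_(Nv, r)) : Prop :=
  [/\ orthonormal_cols (X 0%N), orthonormal_cols (V 0%N)
    & forall n, hybrid_dtp_step (X n) (S n) (V n)
                                (X n.+1) (S n.+1) (V n.+1)].

End HybridDtP.

(* Main.v *)
Require Import Defs.

Import Order.TTheory GRing.Theory Num.Theory.
Local Open Scope ring_scope.

(** Multiplying the K-step by [X'^T] shows that the S-step exactly undoes it:
    [S2 = X'^T X S], so that [L = X'^T U] is a projection of [U] and is not
    longer than [U].  The L-step is backward Euler for [L |-> M2X L A], a
    positive semidefinite operator because [M2 = D^T D] with [D = 1 - E_+] and
    [A] is positive semidefinite; hence it does not increase the norm either. *)

(** This trace is the Frobenius inner product, so norm estimates reduce to matrix algebra under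
    [\tr]. *)
Lemma mxtrace_tr_mulE {R : realType} {m n} (B C : 'M[R]_(m, n)) :
  \tr (B^T *m C) = \sum_i \sum_j B i j * C i j.
Proof.
rewrite /mxtrace exchange_big; apply: eq_bigr => j _.
by rewrite mxE; apply: eq_bigr => i _; rewrite mxE.
Qed.

Lemma mxtrace_tr_mulC {R : realType} {m n} (B C : 'M[R]_(m, n)) :
  \tr (B^T *m C) = \tr (C^T *m B).
Proof. by rewrite -mxtrace_tr trmx_mul trmxK. Qed.

Lemma mxtrace_gram_ge0 {R : realType} {m n} (B : 'M[R]_(m, n)) :
  0 <= \tr (B^T *m B).
Proof.
rewrite mxtrace_tr_mulE; apply: sumr_ge0 => i _.
by apply: sumr_ge0 => j _; rewrite -expr2 sqr_ge0.
Qed.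

Lemma frobenius_normE {R : realType} {m n} (B : 'M[R]_(m, n)) :
  frobenius_norm B = Num.sqrt (\tr (B^T *m B)).
Proof. by rewrite mxtrace_tr_mulE. Qed.

Lemma mxtrace_gramD {R : realType} {m n} (B C : 'M[R]_(m, n)) :
  \tr ((B + C)^T *m (B + C)) =
  \tr (B^T *m B) + \tr (B^T *m C) *+ 2 + \tr (C^T *m C).
Proof.
rewrite [(_ + _)^T]linearD /= mulmxDl !mulmxDr !linearD /= (mxtrace_tr_mulC C B) mulr2n.
by rewrite !addrA.
Qed.

(** By cyclicity the trace is that of [Y *m A *m Y^T], whose diagonal entries are the quadratic form
    of [A] at the rows of [Y]. *)
Lemma mxtrace_gram_psd_ge0 {R : realType} {m n} (A : 'M[R]_n)
    (Y : 'M[R]_(m, n)) :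
  sym_psd A -> 0 <= \tr (Y^T *m Y *m A).
Proof.
case=> _ A_ge0; rewrite -mulmxA mxtrace_mulC /mxtrace.
apply: sumr_ge0 => i _; have := A_ge0 (row i Y)^T.
congr (0 <= _); rewrite trmxK -row_mul !mxE.
by apply: eq_bigr => k _; rewrite !mxE.
Qed.

Lemma frobenius_norm_orthonormal_mul {R : realType} {m r n}
    (Q : 'M[R]_(m, r)) (B : 'M[R]_(r, n)) :
  orthonormal_cols Q -> frobenius_norm (Q *m B) = frobenius_norm B.
Proof.
by move=> QtQ; rewrite !frobenius_normE trmx_mul -mulmxA (mulmxA Q^T) QtQ mul1mx.
Qed.

(** Pythagoras: [Q *m Q^T *m B] is an orthogonal projection of [B], and it has the norm of
    [Q^T *m B]. *)
Lemma frobenius_norm_orthonormal_tr_mul {R : realType} {m r n}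
    (Q : 'M[R]_(m, r)) (B : 'M[R]_(m, n)) :
  orthonormal_cols Q -> frobenius_norm (Q^T *m B) <= frobenius_norm B.
Proof.
move=> QtQ; rewrite -(frobenius_norm_orthonormal_mul Q _ QtQ) !frobenius_normE.
apply: ler_wsqrtr; set P := Q *m _; rewrite -[in leRHS](subrK P B) addrC.
have P_ort : P^T *m (B - P) = 0.
  rewrite /P trmx_mul -mulmxA mulmxBr (mulmxA Q^T Q) QtQ mul1mx subrr.
  by rewrite mulmx0.
by rewrite mxtrace_gramD P_ort mxtrace0 mul0rn addr0 lerDl mxtrace_gram_ge0.
Qed.

(** The transpose of the forward shift is the backward shift, which is also its inverse; the product
    then expands to two identities minus both shifts. *)
Lemma M2_gram (R : realType) n :
  M2 R n = (1%:M - shift_fwd R n)^T *m (1%:M - shift_fwd R n).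
Proof.
have trF : (shift_fwd R n)^T = shift_bwd R n.
  apply/matrixP => i j; rewrite !mxE; congr (nat_of_bool _)%:R.
  apply/eqP/eqP => ->.
    by rewrite ordSK.
  by rewrite ord_predK.
have BF : shift_bwd R n *m shift_fwd R n = 1%:M.
  apply/matrixP => i j; rewrite mxE (bigD1 (ord_pred i)) //= !mxE eqxx mul1r.
  rewrite ord_predK big1 ?addr0 1?eq_sym // => k.
  by rewrite mxE => /negPf ->; rewrite mul0r.
rewrite [(_ - _)^T]linearB /= trmx1 trF mulmxBl !mulmxBr !mul1mx mulmx1 BF opprB.
by rewrite [RHS]addrACA !addrA /M2 (raddfD _ 1 1).
Qed.

(** Backward Euler: expanding the square of [B = L + tau *: G] adds to that of [L] a cross term and
    a square, both nonnegative however large [tau] is. *)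
Lemma implicit_step_norm_le {R : realType} {m n} (tau : R)
    (B G L : 'M[R]_(m, n)) :
  0 <= tau -> 0 <= \tr (L^T *m G) -> L = B - tau *: G ->
  frobenius_norm L <= frobenius_norm B.
Proof.
move=> tau_ge0 LG_ge0 LE; rewrite !frobenius_normE; apply: ler_wsqrtr.
have -> : B = L + tau *: G by rewrite LE subrK.
rewrite mxtrace_gramD -addrA lerDl addr_ge0 ?mxtrace_gram_ge0 //.
by rewrite mulrn_wge0 // -scalemxAr mxtraceZ mulr_ge0.
Qed.

Lemma hybrid_dtp_step_norm_le {R : realType} {Nx Nv r : nat} (A : 'M[R]_Nv)
    (dt dx : R) (X X' : 'M[R]_(Nx, r)) (S S' : 'M[R]_r) (V V' : 'M[R]_(Nv, r)) :
  sym_psd A -> 0 <= dt -> hybrid_dtp_step A dt dx X S V X' S' V' ->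
  frobenius_norm (X' *m S' *m V'^T) <= frobenius_norm (X *m S *m V^T).
Proof.
move=> A_psd dt_ge0 [K' [S1 [S2 [L' []]]]].
set tau := dt / _ => K'E [K'QR X'on _] S2E L'E [L'QR _ _].
have tau_ge0 : 0 <= tau by rewrite divr_ge0 ?sqr_ge0.
have {}L'QR : L' = S' *m V'^T by rewrite -[L']trmxK L'QR trmx_mul trmxK.
have S2_proj : S2 = X'^T *m (X *m S).
  have -> : X *m S = K' + tau *: (M2 R Nx *m K' *m (V^T *m A *m V)).
    by rewrite {1}K'E subrK.
  (* Since [K' = X' *m S1], applying [X'^T] turns [K'] into [S1] and [M2 *m K'] into [M2X *m S1]. *)
  by rewrite S2E [RHS]mulmxDr -scalemxAr K'QR !mulmxA X'on mul1mx.
rewrite -mulmxA -L'QR frobenius_norm_orthonormal_mul //.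
apply: le_trans (frobenius_norm_orthonormal_tr_mul X' (X *m S *m V^T) X'on).
rewrite mulmxA -S2_proj; apply: implicit_step_norm_le tau_ge0 _ L'E.
(* With [Y = D *m X' *m L'], the product [Y^T *m Y *m A] is [L'^T *m (M2X *m L' *m A)]. *)
have := mxtrace_gram_psd_ge0 A ((1%:M - shift_fwd R Nx) *m X' *m L') A_psd.
by rewrite M2_gram !trmx_mul !mulmxA.
Qed.

Theorem theorem4p3 (R : realType) (Nx Nv r : nat) (hr : (r <= minn Nx Nv)%N)
    (A : 'M[R]_Nv) (hA : sym_psd A) (dx : R) (hdx : 0 < dx) :
  forall dt : R, 0 < dt ->
  forall (X : nat -> 'M[R]_(Nx, r)) (S : nat -> 'M[R]_r)
         (V : nat -> 'M[R]_(Nv, r)),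
    hybrid_dtp_iterates A dt dx X S V ->
  forall n : nat,
    frobenius_norm (X n.+1 *m S n.+1 *m (V n.+1)^T)
      <= frobenius_norm (X n *m S n *m (V n)^T).
Proof.
move=> dt dt_gt0 X S V [_ _ step] n.
exact: hybrid_dtp_step_norm_le hA (ltW dt_gt0) (step n).
Qed.
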